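(* Let $0\le r_1<r_2\le+\infty$ and suppose that $f(z)=\sum_{j=-\infty}^{+\infty}a_jz^j$ is a Laurent series centered at zero with complex coefficients, convergent for $r_1<|z|<r_2$. If $f(z)=0$ for all $z$ with $r_1<|z|<r_2$, then $a_j=0$ for all $j\in\mathbb{Z}$.
   Context: The Laurent series means the following: the power series $\sum_{n=0}^{+\infty}a_nz^n$ converges for $|z|<r_2$, the series $\sum_{m=1}^{+\infty}a_{-m}z^{-m}$ converges for $|z|>r_1$, and $f(z)=\sum_{m=1}^{+\infty}a_{-m}z^{-m}+\sum_{n=0}^{+\infty}a_nz^n$ for $r_1<|z|<r_2$. *)

(* Defs.v *)
From Stdlib Require Import Reals ZArith.
From Coquelicot Require Import Coquelicot.

Open Scope C_scope.

Definition annulus (r1 : R) (r2 : Rbar) (z : C) : Prop :=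
  (r1 < Cmod z)%R /\ Rbar_lt (Finite (Cmod z)) r2.

Definition regular_coef (a : Z -> C) (n : nat) : C := a (Z.of_nat n).

(* Indexed from 0: the term of index k is a_{-m} z^{-m} with m = k + 1.
   Division by zero is harmless below, where 0 <= r1 < |z|. *)
Definition principal_term (a : Z -> C) (z : C) (k : nat) : C :=
  a (- Z.of_nat (S k))%Z / z ^ S k.

Definition is_laurent_series (r1 : R) (r2 : Rbar) (a : Z -> C) (f : C -> C)
  : Prop :=
  (forall z : C, Rbar_lt (Finite (Cmod z)) r2 -> ex_pseries (regular_coef a) z)
  /\ (forall z : C, (r1 < Cmod z)%R -> ex_series (principal_term a z))
  /\ (forall z : C, annulus r1 r2 z ->
        exists p q : C,
          is_series (principal_term a z) p
          /\ is_pseries (regular_coef a) z q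
          /\ f z = p + q).

(* Main.v *)
Require Import Defs.
From Stdlib Require Import Reals ZArith.
From Coquelicot Require Import Coquelicot.
From Stdlib Require Import Lra Lia.

Local Open Scope C_scope.

(** On a circle |z| = r inside the annulus both halves of the Laurent series
    converge geometrically fast, uniformly in z: the regular part converges at a
    larger radius and the principal part at a smaller one.  Hence, when f
    vanishes, the truncations S_M of the series (indices from -(M+1) to M) tend
    to 0 uniformly on the circle.

    On the other hand a coefficient of a Laurent polynomial is controlled by the
    values on a circle (Cauchy's estimate [laurent_polynomial_coef_bound]):
    |a_j| r^j is at most the supremum of |S_M| there, as soon as
    -(M+1) <= j <= M.  Letting M tend to infinity gives a_j = 0.

    Since only polynomials are estimated, the contour integral behind Cauchy's
    estimate can be replaced by a finite average: multiplying S_M by z^(M+1)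
    gives a polynomial of degree n = 2M + 1, and averaging over the (n+1)-th
    roots of unity picks out each coefficient exactly
    ([polynomial_coef_bound]). *)

(** A sum [sum_n] has its type in the carrier of an algebraic structure; an
    equation between such terms has to be read in [C] itself before [ring]
    recognises it. *)
Ltac in_C := match goal with |- @eq _ ?x ?y => change (@eq C x y) end.

(** * Finite sums of complex numbers *)

Lemma sum_n_Cmult_l (c : C) (u : nat -> C) (n : nat) :
  sum_n (fun i => c * u i) n = c * sum_n u n.
Proof. exact (@sum_n_mult_l C_Ring c u n). Qed.

Lemma sum_n_C_Sn (u : nat -> C) (n : nat) :
  sum_n u (S n) = sum_n u n + u (S n).
Proof. exact (sum_Sn u n). Qed.

Lemma sum_n_C_shift (u : nat -> C) (n : nat) :
  sum_n u (S n) = u O + sum_n (fun k => u (S k)) n.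
Proof.
  induction n as [|n IH].
  - now rewrite sum_n_C_Sn, !sum_O.
  - rewrite sum_n_C_Sn, IH, (sum_n_C_Sn (fun k => u (S k))). in_C; ring.
Qed.

Lemma Cmod_sum_n_le (u : nat -> C) (B : R) (n : nat) :
  (forall k, (k <= n)%nat -> (Cmod (u k) <= B)%R) ->
  (Cmod (sum_n u n) <= INR (S n) * B)%R.
Proof.
  induction n as [|n IH]; intros Hu.
  - rewrite sum_O. specialize (Hu O (le_n _)). simpl. lra.
  - rewrite sum_n_C_Sn, S_INR.
    eapply Rle_trans; [apply Cmod_triangle|].
    assert (H1 : (Cmod (sum_n u n) <= INR (S n) * B)%R)
      by (apply IH; intros; apply Hu; lia).
    specialize (Hu (S n) (le_n _)). lra.
Qed.

Lemma sum_n_only_term (u : nat -> C) (j n : nat) :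
  (j <= n)%nat -> (forall i, (i <= n)%nat -> i <> j -> u i = 0) ->
  sum_n u n = u j.
Proof.
  revert j; induction n as [|n IH]; intros j Hj Hu.
  - rewrite sum_O. now replace j with O by lia.
  - rewrite sum_n_C_Sn.
    destruct (Nat.eq_dec j (S n)) as [->|Hne].
    + rewrite (sum_n_ext_loc u (fun _ => RtoC 0)) by (intros; apply Hu; lia).
      rewrite (sum_n_ext (fun _ => RtoC 0) (fun _ => RtoC 0 * RtoC 0))
        by (intros; in_C; ring).
      rewrite sum_n_Cmult_l. in_C; ring.
    + rewrite (IH j), (Hu (S n)); try lia; [in_C; ring|].
      intros; apply Hu; lia.
Qed.

Lemma sum_n_Cpow (x : C) (n : nat) :
  (x - 1) * sum_n (fun k => x ^ k) n = x ^ S n - 1.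
Proof.
  induction n as [|n IH].
  - rewrite sum_O. simpl. ring.
  - rewrite sum_n_C_Sn, Cmult_plus_distr_l, IH, !Cpow_S. ring.
Qed.

(** * Roots of unity and Cauchy's estimate for polynomials *)

Lemma Cpow_cos_sin (x : R) (n : nat) :
  (cos x, sin x) ^ n = (cos (INR n * x), sin (INR n * x)).
Proof.
  induction n as [|n IH].
  - simpl. rewrite Rmult_0_l, cos_0, sin_0. reflexivity.
  - rewrite Cpow_S, IH, S_INR, Rmult_plus_distr_r, Rmult_1_l, cos_plus, sin_plus.
    unfold Cmult; simpl. f_equal; ring.
Qed.

Lemma primitive_root_of_unity (n : nat) :
  (0 < n)%nat ->
  exists w : C, Cmod w = 1%R /\ w ^ n = 1 /\
    forall l, (0 < l < n)%nat -> w ^ l <> 1.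
Proof.
  intros Hn.
  assert (Hn0 : (0 < INR n)%R) by now apply lt_0_INR.
  exists (cos (2 * PI / INR n), sin (2 * PI / INR n)).
  split; [|split].
  - unfold Cmod; simpl. transitivity (sqrt 1); [f_equal|apply sqrt_1].
    pose proof (sin2_cos2 (2 * PI / INR n)) as H. unfold Rsqr in H. lra.
  - rewrite Cpow_cos_sin.
    replace (INR n * (2 * PI / INR n))%R with (2 * PI)%R by (field; lra).
    now rewrite cos_2PI, sin_2PI.
  - intros l [Hl0 Hln] H. rewrite Cpow_cos_sin in H.
    apply (f_equal fst) in H; simpl in H.
    (* cos x = 1 - 2 sin^2 (x/2), and here 0 < x/2 < pi. *)
    replace (INR l * (2 * PI / INR n))%R with (2 * (INR l / INR n * PI))%R in H
      by (field; lra).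
    rewrite cos_2a_sin in H.
    apply lt_INR in Hl0, Hln. simpl in Hl0.
    assert (0 < INR l / INR n < 1)%R.
    { split; [apply Rdiv_lt_0_compat; lra|].
      apply Rlt_div_l; lra. }
    pose proof PI_RGT_0.
    assert (0 < sin (INR l / INR n * PI))%R by (apply sin_gt_0; nra).
    nra.
Qed.

(** The sum over k of w^(k(N-j)) P(r w^k), where w is a primitive N-th root of
    unity and N = n + 1, equals N c_j r^j: for i <> j the terms c_i contribute a
    geometric sum of ratio x = w^(N-j+i), and it vanishes because x^N = 1 and
    x <> 1. *)
Lemma polynomial_coef_bound (c : nat -> C) (n j : nat) (r B : R) :
  (0 <= r)%R -> (j <= n)%nat ->
  (forall z : C, Cmod z = r -> (Cmod (sum_n (fun i => c i * z ^ i)%C n) <= B)%R) ->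
  (Cmod (c j) * r ^ j <= B)%R.
Proof.
  intros Hr Hj HB.
  destruct (primitive_root_of_unity (S n)) as (w & Hw1 & HwN & Hwne); [lia|].
  set (P := fun z : C => sum_n (fun i => c i * z ^ i) n).
  assert (Hav : sum_n (fun k => (w ^ k) ^ (S n - j) * P (r * w ^ k)) n
                = INR (S n) * (c j * r ^ j)).
  { unfold P.
    rewrite (sum_n_ext _ (fun k => sum_n (fun i =>
               c i * r ^ i * (w ^ (S n - j + i)) ^ k) n)).
    2:{ intros k. rewrite <- sum_n_Cmult_l. apply sum_n_ext; intros i.
        rewrite Cpow_mult_l, <- !Cpow_mult_r.
        replace ((S n - j + i) * k)%nat with (k * (S n - j) + k * i)%nat by lia.
        rewrite Cpow_add_r. in_C; ring. }
    rewrite sum_n_switch.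
    rewrite (sum_n_ext _ (fun i => c i * r ^ i *
               sum_n (fun k => (w ^ (S n - j + i)) ^ k) n))
      by (intros; apply sum_n_Cmult_l).
    rewrite (sum_n_only_term _ j); [|exact Hj|].
    - replace (S n - j + j)%nat with (S n) by lia. rewrite HwN.
      assert (Hone : forall m, sum_n (fun k => RtoC 1 ^ k) m = RtoC (INR (S m))).
      { induction m as [|m IH].
        - rewrite sum_O. reflexivity.
        - rewrite sum_n_C_Sn, IH, Cpow_1_l, (S_INR (S m)), RtoC_plus.
          reflexivity. }
      rewrite Hone. in_C; ring.
    - intros i Hi Hne.
      assert (Hx : w ^ (S n - j + i) <> 1).
      { destruct (Nat.lt_ge_cases i j).
        - apply Hwne; lia.
        - replace (S n - j + i)%nat with (S n + (i - j))%nat by lia.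
          rewrite Cpow_add_r, HwN, Cmult_1_l. apply Hwne; lia. }
      set (x := w ^ (S n - j + i)) in *.
      assert (Hx0 : x - 1 <> 0).
      { intros H. apply Hx. replace x with (x - 1 + 1) by ring.
        rewrite H. ring. }
      pose proof (sum_n_Cpow x n) as Hg.
      assert (HxN : x ^ S n = 1).
      { unfold x. rewrite <- Cpow_mult_r, Nat.mul_comm, Cpow_mult_r, HwN.
        apply Cpow_1_l. }
      rewrite HxN in Hg.
      replace (sum_n (fun k => x ^ k) n)
        with (/ (x - 1) * ((x - 1) * sum_n (fun k => x ^ k) n))
        by (field; exact Hx0).
      rewrite Hg. ring. }
  assert (Hle : (Cmod (sum_n (fun k => (w ^ k) ^ (S n - j) * P (r * w ^ k))%C n)
                 <= INR (S n) * B)%R).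
  { apply Cmod_sum_n_le. intros k _.
    rewrite Cmod_mult, !Cmod_pow, Hw1, !pow1, Rmult_1_l.
    apply HB. rewrite Cmod_mult, Cmod_pow, Hw1, pow1, Cmod_R, Rabs_pos_eq; lra. }
  rewrite Hav, !Cmod_mult, Cmod_pow, !Cmod_R, (Rabs_pos_eq r) in Hle by exact Hr.
  pose proof (lt_0_INR (S n) (Nat.lt_0_succ n)).
  rewrite Rabs_pos_eq in Hle by lra.
  now apply (Rmult_le_reg_l (INR (S n))).
Qed.

(** * Cauchy's estimate for Laurent polynomials *)

(** The factor z^(M+1) clears the denominators; in the induction on M one more
    term is added at each end, hence the shift of the summation index. *)
Lemma laurent_polynomial_shift (a : Z -> C) (M : nat) (z : C) :
  z <> 0 ->
  z ^ S M * (sum_n (principal_term a z) M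
             + sum_n (fun n => regular_coef a n * z ^ n) M)
  = sum_n (fun i => a (Z.of_nat i - Z.of_nat (S M))%Z * z ^ i) (S (2 * M)).
Proof.
  intros Hz. induction M as [|M IH].
  - rewrite sum_n_C_Sn, !sum_O. unfold principal_term, regular_coef. simpl.
    field. exact Hz.
  - replace (S (2 * S M))%nat with (S (S (S (2 * M)))) by lia.
    rewrite (sum_n_C_Sn _ (S (S (2 * M)))), (sum_n_C_shift _ (S (2 * M))).
    rewrite (sum_n_ext
      (fun k => a (Z.of_nat (S k) - Z.of_nat (S (S M)))%Z * z ^ S k)
      (fun k => z * (a (Z.of_nat k - Z.of_nat (S M))%Z * z ^ k))).
    2:{ intros k. rewrite Cpow_S.
        replace (Z.of_nat (S k) - Z.of_nat (S (S M)))%Z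
          with (Z.of_nat k - Z.of_nat (S M))%Z by lia. in_C; ring. }
    rewrite sum_n_Cmult_l, <- IH, !(sum_n_C_Sn _ M).
    unfold principal_term at 2, regular_coef at 2.
    replace (Z.of_nat 0 - Z.of_nat (S (S M)))%Z
      with (- Z.of_nat (S (S M)))%Z by lia.
    replace (Z.of_nat (S (S (S (2 * M)))) - Z.of_nat (S (S M)))%Z
      with (Z.of_nat (S M)) by lia.
    replace (S (S (S (2 * M)))) with (S (S M) + S M)%nat by lia.
    rewrite Cpow_add_r, (Cpow_S z (S M)).
    pose proof (Cpow_nz z (S M) Hz).
    simpl (z ^ 0). field. now split.
Qed.

(** Cauchy's estimate for the polynomial of [laurent_polynomial_shift]; the
    factor r^(M+1) appears on both sides and cancels. *)
Lemma laurent_polynomial_coef_bound (a : Z -> C) (M : nat) (j : Z) (r B : R) :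
  (0 < r)%R -> (- Z.of_nat (S M) <= j <= Z.of_nat M)%Z ->
  (forall z : C, Cmod z = r ->
     (Cmod (sum_n (principal_term a z) M
            + sum_n (fun n => regular_coef a n * z ^ n)%C M) <= B)%R) ->
  (Cmod (a j) * powerRZ r j <= B)%R.
Proof.
  intros Hr Hj HB.
  set (c := fun i => a (Z.of_nat i - Z.of_nat (S M))%Z).
  set (i := Z.to_nat (j + Z.of_nat (S M))).
  assert (Hi : Z.of_nat i = (j + Z.of_nat (S M))%Z) by (unfold i; lia).
  assert (Hc : (Cmod (c i) * r ^ i <= r ^ S M * B)%R).
  { apply (polynomial_coef_bound c (S (2 * M))); [lra|lia|].
    intros z Hz. unfold c.
    rewrite <- laurent_polynomial_shift.
    - rewrite Cmod_mult, Cmod_pow, Hz.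
      apply Rmult_le_compat_l; [apply pow_le; lra|now apply HB].
    - apply Cmod_gt_0. lra. }
  unfold c in Hc. rewrite (pow_powerRZ r i), Hi in Hc.
  replace (j + Z.of_nat (S M) - Z.of_nat (S M))%Z with j in Hc by lia.
  rewrite powerRZ_add, <- pow_powerRZ in Hc by lra.
  apply (Rmult_le_reg_l (r ^ S M)); [now apply pow_lt|]. lra.
Qed.

(** * Series dominated by geometric ones *)

(** Each term is a difference of two partial sums, and these are bounded. *)
Lemma ex_series_C_bounded (u : nat -> C) :
  ex_series u -> exists B, (0 <= B)%R /\ forall n, (Cmod (u n) <= B)%R.
Proof.
  intros Hu. destruct (filterlim_bounded (sum_n u) Hu) as [B HB].
  assert (HB' : forall n, (Cmod (sum_n u n) <= B)%R) by exact HB.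
  assert (HB0 : (0 <= B)%R)
    by (eapply Rle_trans; [apply Cmod_ge_0|apply (HB' O)]).
  exists (2 * B)%R. split; [lra|]. intros [|n].
  - specialize (HB' O). rewrite sum_O in HB'. lra.
  - replace (u (S n)) with (sum_n u (S n) + - sum_n u n)
      by (rewrite sum_n_C_Sn; in_C; ring).
    eapply Rle_trans; [apply Cmod_triangle|]. rewrite Cmod_opp.
    pose proof (HB' n). pose proof (HB' (S n)). lra.
Qed.

Lemma is_series_Cmod_le_geom (u : nat -> C) (l : C) (B q : R) :
  (0 <= q < 1)%R -> (0 <= B)%R ->
  (forall n, (Cmod (u n) <= B * q ^ n)%R) ->
  is_series u l -> (Cmod l <= B / (1 - q))%R.
Proof.
  intros Hq HB0 Hu Hl.
  assert (Hpart : forall n, (Cmod (sum_n u n) <= B * (1 - q ^ S n) / (1 - q))%R).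
  { induction n as [|n IH].
    - rewrite sum_O. eapply Rle_trans; [apply Hu|].
      right. simpl. field. lra.
    - rewrite sum_n_C_Sn. eapply Rle_trans; [apply Cmod_triangle|].
      eapply Rle_trans; [apply Rplus_le_compat; [apply IH|apply Hu]|].
      right. simpl. field. lra. }
  assert (Hlim : is_lim_seq (fun n => Cmod (sum_n u n)) (Cmod l)).
  { apply (filterlim_comp _ _ _ (sum_n u) Cmod eventually (locally l)); [exact Hl|].
    exact (@filterlim_norm C_AbsRing C_NormedModule l). }
  refine (is_lim_seq_le _ _ (Finite _) (Finite _) _ Hlim (is_lim_seq_const _)).
  intros n. eapply Rle_trans; [apply Hpart|].
  unfold Rdiv. apply Rmult_le_compat_r; [apply Rlt_le, Rinv_0_lt_compat; lra|].
  assert (0 <= q ^ S n)%R by (apply pow_le; lra). nra.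
Qed.

Lemma series_tail_le_geom (u : nat -> C) (l : C) (B q : R) (M : nat) :
  (0 <= q < 1)%R -> (0 <= B)%R ->
  (forall n, (Cmod (u n) <= B * q ^ n)%R) ->
  is_series u l -> (Cmod (l - sum_n u M) <= B / (1 - q) * q ^ S M)%R.
Proof.
  intros Hq HB0 Hu Hl.
  replace (B / (1 - q) * q ^ S M)%R with (B * q ^ S M / (1 - q))%R
    by (field; lra).
  apply (is_series_Cmod_le_geom (fun k => u (S M + k)%nat)); [exact Hq| | |].
  - apply Rmult_le_pos; [exact HB0|apply pow_le; lra].
  - intros n. eapply Rle_trans; [apply Hu|].
    rewrite pow_add. right. ring.
  - apply is_series_incr_n; [lia|]. simpl Init.Nat.pred.
    match goal with |- is_series _ ?x => replace x with l; [exact Hl|] end.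
    change (l = l - sum_n u M + sum_n u M). ring.
Qed.

Lemma pow_n_Cpow (z : C) (n : nat) : pow_n (K := C_Ring) z n = z ^ n.
Proof. induction n as [|n IH]; [reflexivity|]. simpl. now rewrite IH. Qed.

(** Abel's argument: the terms at the larger radius t are bounded. *)
Lemma regular_term_le_geom (a : Z -> C) (r t : R) :
  (0 <= r)%R -> (0 < t)%R -> ex_pseries (regular_coef a) (RtoC t) ->
  exists B, (0 <= B)%R /\ forall z n, Cmod z = r ->
    (Cmod (regular_coef a n * z ^ n) <= B * (r / t) ^ n)%R.
Proof.
  intros Hr Ht Hex.
  destruct (ex_series_C_bounded _ Hex) as (B & HB0 & HB).
  exists B. split; [exact HB0|]. intros z n Hz.
  specialize (HB n).
  change (Cmod (pow_n (K := C_Ring) (RtoC t) n * regular_coef a n) <= B)%R in HB.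
  rewrite pow_n_Cpow, Cmod_mult, Cmod_pow, Cmod_R, Rabs_pos_eq in HB by lra.
  rewrite Cmod_mult, Cmod_pow, Hz.
  replace (r ^ n)%R with (t ^ n * (r / t) ^ n)%R
    by (rewrite <- Rpow_mult_distr; f_equal; field; lra).
  assert (0 <= (r / t) ^ n)%R
    by (apply pow_le; apply Rmult_le_pos; [lra|apply Rlt_le, Rinv_0_lt_compat, Ht]).
  nra.
Qed.

(** The same argument at a smaller radius s.  The term of index k carries
    z^-(k+1), so the ratio appears to the power k+1; one factor s/r <= 1 is given
    away. *)
Lemma principal_term_le_geom (a : Z -> C) (s r : R) :
  (0 < s <= r)%R -> ex_series (principal_term a (RtoC s)) ->
  exists B, (0 <= B)%R /\ forall z k, Cmod z = r ->
    (Cmod (principal_term a z k) <= B * (s / r) ^ k)%R.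
Proof.
  intros Hs Hex.
  destruct (ex_series_C_bounded _ Hex) as (B & HB0 & HB).
  exists B. split; [exact HB0|]. intros z k Hz.
  specialize (HB k). unfold principal_term in *.
  assert (Hz0 : z <> 0) by (apply Cmod_gt_0; lra).
  assert (Hs0 : RtoC s <> 0)
    by (apply Cmod_gt_0; rewrite Cmod_R, Rabs_pos_eq; lra).
  rewrite Cmod_div, Cmod_pow, Cmod_R, Rabs_pos_eq in HB
    by (try apply Cpow_nz; trivial; lra).
  rewrite Cmod_div, Cmod_pow, Hz by (now apply Cpow_nz).
  set (A := Cmod _) in *.
  assert (Hq : (0 <= s / r <= 1)%R).
  { split; [apply Rlt_le, Rdiv_lt_0_compat; lra|].
    apply Rle_div_l; lra. }
  assert (Hqk : (0 <= (s / r) ^ k)%R) by (apply pow_le; lra).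
  replace (A / r ^ S k)%R with (A / s ^ S k * ((s / r) * (s / r) ^ k))%R.
  - apply Rmult_le_compat; [|nra|exact HB|nra].
    apply Rmult_le_pos; [apply Cmod_ge_0|].
    apply Rlt_le, Rinv_0_lt_compat, pow_lt; lra.
  - change (s / r * (s / r) ^ k)%R with ((s / r) ^ S k)%R.
    unfold Rdiv at 2. rewrite Rpow_mult_distr, pow_inv.
    field. split; apply pow_nonzero; lra.
Qed.

(** * Uniqueness of the Laurent expansion *)

Lemma Rbar_lt_between (x : R) (y : Rbar) :
  Rbar_lt x y -> exists t : R, (x < t)%R /\ Rbar_lt t y.
Proof.
  destruct y as [y| |]; simpl; intros H.
  - exists ((x + y) / 2)%R. lra.
  - exists (x + 1)%R. split; [lra|exact I].
  - contradiction.
Qed.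

Theorem corollary13p2 (r1 : R) (r2 : Rbar) (a : Z -> C) (f : C -> C)
    (hr1 : (0 <= r1)%R) (hr12 : Rbar_lt (Finite r1) r2)
    (hf : is_laurent_series r1 r2 a f)
    (hf0 : forall z : C, annulus r1 r2 z -> f z = RtoC 0) :
  forall j : Z, a j = RtoC 0.
Proof.
  intros j. destruct hf as (Hreg & Hprin & Hsum).
  destruct (Rbar_lt_between _ _ hr12) as (r & Hr1 & Hr2).
  destruct (Rbar_lt_between _ _ Hr2) as (t & Hrt & Ht2).
  set (s := ((r1 + r) / 2)%R).
  assert (Hs : (r1 < s < r)%R) by (unfold s; lra).
  destruct (regular_term_le_geom a r t) as (B & HB0 & HB); [lra|lra| |].
  { apply Hreg. rewrite Cmod_R, Rabs_pos_eq; [exact Ht2|lra]. }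
  destruct (principal_term_le_geom a s r) as (D & HD0 & HD); [lra| |].
  { apply Hprin. rewrite Cmod_R, Rabs_pos_eq; lra. }
  assert (Hq : forall x y, (0 < x < y)%R -> (0 <= x / y < 1)%R).
  { intros x y H. split; [apply Rlt_le, Rdiv_lt_0_compat; lra|].
    apply Rlt_div_l; lra. }
  assert (Hq1 := Hq r t ltac:(lra)). assert (Hq2 := Hq s r ltac:(lra)).
  set (q1 := (r / t)%R) in *. set (q2 := (s / r)%R) in *.
  assert (Hbound : forall M, (Z.to_nat (Z.abs j) <= M)%nat ->
    (Cmod (a j) * powerRZ r j
     <= D / (1 - q2) * q2 ^ S M + B / (1 - q1) * q1 ^ S M)%R).
  { intros M HM.
    apply (laurent_polynomial_coef_bound a M); [lra|lia|]. intros z Hz.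
    assert (Hann : annulus r1 r2 z) by (split; rewrite Hz; assumption).
    destruct (Hsum z Hann) as (p & q & Hp & Hser & Hpq).
    rewrite (hf0 z Hann) in Hpq.
    assert (Hser' : is_series (fun n => regular_coef a n * z ^ n) q).
    { eapply is_series_ext; [|exact Hser]. intros n. simpl.
      change (pow_n (K := C_Ring) z n * regular_coef a n
              = regular_coef a n * z ^ n).
      rewrite pow_n_Cpow. ring. }
    pose proof (series_tail_le_geom _ _ D q2 M Hq2 HD0
                  (fun k => HD z k Hz) Hp) as H1.
    pose proof (series_tail_le_geom _ _ B q1 M Hq1 HB0
                  (fun n => HB z n Hz) Hser') as H2.
    set (S1 := sum_n (principal_term a z) M) in *.
    set (S2 := sum_n (fun n => regular_coef a n * z ^ n) M) in *.
    (* As p + q = 0, the truncation is minus the sum of the two tails. *)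
    replace (S1 + S2) with (p + q - (p - S1 + (q - S2))) by ring.
    rewrite <- Hpq.
    replace (0 - (p - S1 + (q - S2))) with (- (p - S1 + (q - S2))) by ring.
    rewrite Cmod_opp. eapply Rle_trans; [apply Cmod_triangle|]. lra. }
  assert (Hlim : is_lim_seq
    (fun M => D / (1 - q2) * q2 ^ S M + B / (1 - q1) * q1 ^ S M)%R 0).
  { apply (is_lim_seq_incr_1
      (fun M => D / (1 - q2) * q2 ^ M + B / (1 - q1) * q1 ^ M)%R).
    replace (Finite 0) with
      (Finite (D / (1 - q2) * 0 + B / (1 - q1) * 0)) by (f_equal; ring).
    apply is_lim_seq_plus'; apply (is_lim_seq_scal_l _ _ (Finite 0));
      apply is_lim_seq_geom; rewrite Rabs_pos_eq; lra. }
  assert (Hle : Rbar_le (Cmod (a j) * powerRZ r j)%R 0).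
  { refine (is_lim_seq_le_loc _ _ _ _ _ (is_lim_seq_const _) Hlim).
    exists (Z.to_nat (Z.abs j)). exact Hbound. }
  simpl in Hle.
  assert (Hpos : (0 < powerRZ r j)%R) by (apply powerRZ_lt; lra).
  apply Cmod_eq_0. pose proof (Cmod_ge_0 (a j)). nra.
Qed.
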